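(* (Soundness of dead code elimination.) Let $S,S'$ be statements, $\mathit{pts},\mathit{pts}'\in\mathit{PTS}$, $l,l'\subseteq\mathit{Var}$, and $\gamma,\gamma_*\in\Gamma$. Suppose that $S:(\mathit{pts},l)\to(\mathit{pts}',l')\hookrightarrow S'$ is derivable in the dead-code-elimination type system and that $\gamma\sim_{(\mathit{pts},l)}\gamma_*$. Then: 1. If $S:\gamma\rightsquigarrow\gamma'$ with $\gamma'\in\Gamma$, then there exists a state $\gamma_*'\in\Gamma$ such that $S':\gamma_*\rightsquigarrow\gamma_*'$ and $\gamma'\sim_{(\mathit{pts}',l')}\gamma_*'$. 2. If $S':\gamma_*\rightsquigarrow\gamma_*'$ with $\gamma_*'\in\Gamma$ and $S$ does not abort at $\gamma$ (i.e. $S:\gamma\rightsquigarrow\mathit{abort}$ does not hold), then there exists a state $\gamma'\in\Gamma$ such that $S:\gamma\rightsquigarrow\gamma'$ and $\gamma'\sim_{(\mathit{pts}',l')}\gamma_*'$.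
   Context: **Syntax.** $\mathit{Var}$ is a set of variables; $n$ ranges over $\mathbb{Z}$, $x,y,z$ over $\mathit{Var}$, $\oplus$ over $\{+,-,\times\}$. Arithmetic expressions: $e ::= x\mid n\mid e_1\oplus e_2$. Boolean expressions: $b ::= \mathit{true}\mid\mathit{false}\mid\neg b\mid e_1=e_2\mid e_1\le e_2\mid b_1\wedge b_2\mid b_1\vee b_2$. $FV(e)$, $FV(b)$ denote the sets of variables occurring in $e$, $b$. Statements: $S ::= x:=e\mid x:=\&y\mid *x:=e\mid x:=*y\mid \mathit{skip}\mid S_1;S_2\mid \mathit{if}\ b\ \mathit{then}\ S_t\ \mathit{else}\ S_f\mid \mathit{while}\ b\ \mathit{do}\ S_t\mid \mathit{par}\{\{S_1\},\ldots,\{S_n\}\}\mid \mathit{par\text{-}if}\{(b_1,S_1),\ldots,(b_n,S_n)\}\mid \mathit{par\text{-}for}\{S\}$, with $n\ge 1$. **States.** $\mathit{Addrs}=\{x'\mid x\in\mathit{Var}\}$ (a formal address $x'$ for each variable $x$, distinct for distinct variables), $\mathbb{Z}\cap\mathit{Addrs}=\emptyset$, $\mathit{Val}=\mathbb{Z}\cup\mathit{Addrs}$, $\Gamma=\mathit{Var}\to\mathit{Val}$; the states are the elements of $\Gamma\cup\{\mathit{abort}\}$. **Expression semantics** ($!$ is an error value). $[\![n]\!]\gamma=n$; $[\![x]\!]\gamma=\gamma(x)$; $[\![e_1\oplus e_2]\!]\gamma=[\![e_1]\!]\gamma\oplus[\![e_2]\!]\gamma$ if both values are in $\mathbb{Z}$,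 else $!$; $[\![\mathit{true}]\!]\gamma=\mathit{true}$, $[\![\mathit{false}]\!]\gamma=\mathit{false}$; $[\![e_1=e_2]\!]\gamma$ is $!$ if either side is $!$, else $\mathit{true}$ if the values are equal and $\mathit{false}$ otherwise; $[\![e_1\le e_2]\!]\gamma$ is $!$ if either value is not in $\mathbb{Z}$, else the truth value of the comparison; $\neg,\wedge,\vee$ are as usual, with result $!$ if any operand is $!$. **Operational semantics.** $S:\gamma\rightsquigarrow\mathit{state}$ (with $\gamma\in\Gamma$, $\mathit{state}\in\Gamma\cup\{\mathit{abort}\}$) is the relation inductively defined by: - $x:=e:\gamma\rightsquigarrow\mathit{abort}$ if $[\![e]\!]\gamma={!}$; otherwise $x:=e:\gamma\rightsquigarrow\gamma[x\mapsto[\![e]\!]\gamma]$. - $x:=\&y:\gamma\rightsquigarrow\gamma[x\mapsto y']$; $\mathit{skip}:\gamma\rightsquigarrow\gamma$. - $*x:=e:\gamma\rightsquigarrow\mathit{state}$ if $\gamma(x)=z'$ and $z:=e:\gamma\rightsquigarrow\mathit{state}$; $*x:=e:\gamma\rightsquigarrow\mathit{abort}$ if $\gamma(x)\notin\mathit{Addrs}$. - $x:=*y:\gamma\rightsquigarrow\gamma'$ if $\gamma(y)=z'$ and $x:=z:\gamma\rightsquigarrow\gamma'$; $x:=*y:\gamma\rightsquigarrow\mathit{abort}$ if $\gamma(y)\notin\mathit{Addrs}$. - $S_1;S_2:\gamma\rightsquigarrow\mathit{abort}$ if $S_1:\gamma\rightsquigarrow\mathit{abort}$; $S_1;S_2:\gamma\rightsquigarrow\mathit{state}$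 if $S_1:\gamma\rightsquigarrow\gamma''\in\Gamma$ and $S_2:\gamma''\rightsquigarrow\mathit{state}$. - $\mathit{if}\ b\ \mathit{then}\ S_t\ \mathit{else}\ S_f:\gamma\rightsquigarrow\mathit{abort}$ if $[\![b]\!]\gamma={!}$; it $\rightsquigarrow\mathit{state}$ if $[\![b]\!]\gamma=\mathit{true}$ and $S_t:\gamma\rightsquigarrow\mathit{state}$, or $[\![b]\!]\gamma=\mathit{false}$ and $S_f:\gamma\rightsquigarrow\mathit{state}$. - $\mathit{while}\ b\ \mathit{do}\ S_t:\gamma\rightsquigarrow\mathit{abort}$ if $[\![b]\!]\gamma={!}$; it $\rightsquigarrow\gamma$ if $[\![b]\!]\gamma=\mathit{false}$; if $[\![b]\!]\gamma=\mathit{true}$, it $\rightsquigarrow\mathit{abort}$ when $S_t:\gamma\rightsquigarrow\mathit{abort}$, and it $\rightsquigarrow\mathit{state}$ when $S_t:\gamma\rightsquigarrow\gamma''\in\Gamma$ and $\mathit{while}\ b\ \mathit{do}\ S_t:\gamma''\rightsquigarrow\mathit{state}$. - $\mathit{par}\{\{S_1\},\ldots,\{S_n\}\}:\gamma\rightsquigarrow\gamma'$ if there are a permutation $\theta$ of $\{1,\ldots,n\}$ and states $\gamma=\gamma_1,\ldots,\gamma_{n+1}=\gamma'$ in $\Gamma$ with $S_{\theta(i)}:\gamma_i\rightsquigarrow\gamma_{i+1}$ for all $1\le i\le n$. It $\rightsquigarrow\mathit{abort}$ if there are $1\le m\le n$, an injective $\beta:\{1,\ldots,m\}\to\{1,\ldots,n\}$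 and states $\gamma=\gamma_1,\ldots,\gamma_{m+1}=\mathit{abort}$ with $S_{\beta(i)}:\gamma_i\rightsquigarrow\gamma_{i+1}$ for all $1\le i\le m$. - $\mathit{par\text{-}if}\{(b_1,S_1),\ldots,(b_n,S_n)\}:\gamma\rightsquigarrow\mathit{state}$ if $\mathit{par}\{\{\mathit{if}\ b_1\ \mathit{then}\ S_1\ \mathit{else}\ \mathit{skip}\},\ldots,\{\mathit{if}\ b_n\ \mathit{then}\ S_n\ \mathit{else}\ \mathit{skip}\}\}:\gamma\rightsquigarrow\mathit{state}$. - $\mathit{par\text{-}for}\{S\}:\gamma\rightsquigarrow\mathit{state}$ if for some $n\ge1$, $\mathit{par}\{\{S\},\ldots,\{S\}\}:\gamma\rightsquigarrow\mathit{state}$ with $n$ copies of $S$. **Points-to types.** $\mathit{PTS}$ is the set of maps $\mathit{pts}:\mathit{Var}\to 2^{\mathit{Addrs}}$; $\mathit{pts}\le\mathit{pts}'$ iff $\mathit{pts}(x)\subseteq\mathit{pts}'(x)$ for all $x$; $\cup$ on $\mathit{PTS}$ is pointwise union. **Pointer-analysis type system.** Expression judgements $e:\mathit{pts}\to A$ ($A\subseteq\mathit{Addrs}$): $n:\mathit{pts}\to\emptyset$; $x:\mathit{pts}\to\mathit{pts}(x)$; $e_1\oplus e_2:\mathit{pts}\to\emptyset$. The only statement judgements $S:\mathit{pts}\to\mathit{pts}'$ of this system needed below are those for assignments, derived by: $x:=e:\mathit{pts}\to\mathit{pts}[x\mapsto A]$ if $e:\mathit{pts}\to A$; $x:=*y:\mathit{pts}\to\mathit{pts}'$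 if $x:=z:\mathit{pts}\to\mathit{pts}'$ for all $z'\in\mathit{pts}(y)$; $*x:=e:\mathit{pts}\to\mathit{pts}'$ if $z:=e:\mathit{pts}\to\mathit{pts}'$ for all $z'\in\mathit{pts}(x)$; and the consequence rule: $S:\mathit{pts}_1'\to\mathit{pts}_2'$ if $\mathit{pts}_1'\le\mathit{pts}_1$, $S:\mathit{pts}_1\to\mathit{pts}_2$ and $\mathit{pts}_2\le\mathit{pts}_2'$. **Dead-code-elimination type system.** Live types are pairs $(\mathit{pts},l)\in\mathit{PTS}\times\mathcal{P}(\mathit{Var})$, with $(\mathit{pts},l)\le(\mathit{pts}',l')$ iff $\mathit{pts}\le\mathit{pts}'$ and $l\supseteq l'$. Judgements $S:(\mathit{pts},l)\to(\mathit{pts}',l')\hookrightarrow S'$ are inductively derived by the following rules (premises without live components are pointer-analysis judgements): - if $x:=e:\mathit{pts}\to\mathit{pts}'$ and $x\notin l'$: $x:=e:(\mathit{pts},l')\to(\mathit{pts}',l')\hookrightarrow\mathit{skip}$. - if $x:=e:\mathit{pts}\to\mathit{pts}'$ and $x\in l'$: $x:=e:(\mathit{pts},(l'\setminus\{x\})\cup FV(e))\to(\mathit{pts}',l')\hookrightarrow x:=e$. - if $x\notin l'$: $x:=\&y:(\mathit{pts},l')\to(\mathit{pts}[x\mapsto\{y'\}],l')\hookrightarrow\mathit{skip}$. - if $x\in l'$: $x:=\&y:(\mathit{pts},l'\setminus\{x\})\to(\mathit{pts}[x\mapsto\{y'\}],l')\hookrightarrow x:=\&y$. - $\mathit{skip}:(\mathit{pts},l)\to(\mathit{pts},l)\hookrightarrow\mathit{skip}$.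 - if $x:=*y:\mathit{pts}\to\mathit{pts}'$ and $x\notin l'$: $x:=*y:(\mathit{pts},l'\cup\{y\})\to(\mathit{pts}',l')\hookrightarrow\mathit{skip}$. - if $x:=*y:\mathit{pts}\to\mathit{pts}'$ and $x\in l'$: $x:=*y:(\mathit{pts},(l'\setminus\{x\})\cup\{y\}\cup\{z\mid z'\in\mathit{pts}(y)\})\to(\mathit{pts}',l')\hookrightarrow x:=*y$. - if $*x:=e:\mathit{pts}\to\mathit{pts}'$ and $\{z\mid z'\in\mathit{pts}(x)\}\cap l'=\emptyset$: $*x:=e:(\mathit{pts},l'\cup\{x\})\to(\mathit{pts}',l')\hookrightarrow\mathit{skip}$. - if $*x:=e:\mathit{pts}\to\mathit{pts}'$ and $\{z\mid z'\in\mathit{pts}(x)\}\cap l'\neq\emptyset$: $*x:=e:(\mathit{pts},l'\cup\{x\}\cup FV(e))\to(\mathit{pts}',l')\hookrightarrow *x:=e$. - if for every $i$, $S_i:(\mathit{pts}\cup\bigcup_{j\ne i}\mathit{pts}_j,\,l_i)\to(\mathit{pts}_i,\,l'\cup\bigcup_{j\neq i}l_j)\hookrightarrow S_i'$: $\mathit{par}\{\{S_1\},\ldots,\{S_n\}\}:(\mathit{pts},\bigcup_i l_i)\to(\bigcup_i\mathit{pts}_i,l')\hookrightarrow\mathit{par}\{\{S_1'\},\ldots,\{S_n'\}\}$. - if $\mathit{par}\{\{\mathit{if}\ b_1\ \mathit{then}\ S_1\ \mathit{else}\ \mathit{skip}\},\ldots,\{\mathit{if}\ b_n\ \mathit{then}\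 S_n\ \mathit{else}\ \mathit{skip}\}\}:(\mathit{pts},l)\to(\mathit{pts}',l')\hookrightarrow\mathit{par}\{\{\mathit{if}\ b_1\ \mathit{then}\ S_1'\ \mathit{else}\ \mathit{skip}\},\ldots,\{\mathit{if}\ b_n\ \mathit{then}\ S_n'\ \mathit{else}\ \mathit{skip}\}\}$: $\mathit{par\text{-}if}\{(b_1,S_1),\ldots,(b_n,S_n)\}:(\mathit{pts},l)\to(\mathit{pts}',l')\hookrightarrow\mathit{par\text{-}if}\{(b_1,S_1'),\ldots,(b_n,S_n')\}$. - if $S:(\mathit{pts}\cup\mathit{pts}',l)\to(\mathit{pts}',l'\cup l)\hookrightarrow S'$: $\mathit{par\text{-}for}\{S\}:(\mathit{pts},l)\to(\mathit{pts}',l')\hookrightarrow\mathit{par\text{-}for}\{S'\}$. - if $S_1:(\mathit{pts},l)\to(\mathit{pts}'',l'')\hookrightarrow S_1'$ and $S_2:(\mathit{pts}'',l'')\to(\mathit{pts}',l')\hookrightarrow S_2'$: $S_1;S_2:(\mathit{pts},l)\to(\mathit{pts}',l')\hookrightarrow S_1';S_2'$. - if $S_t:(\mathit{pts},l)\to(\mathit{pts}',l')\hookrightarrow S_t'$ and $S_f:(\mathit{pts},l)\to(\mathit{pts}',l')\hookrightarrow S_f'$: $\mathit{if}\ b\ \mathit{then}\ S_t\ \mathit{else}\ S_f:(\mathit{pts},l\cup FV(b))\to(\mathit{pts}',l')\hookrightarrow\mathit{if}\ b\ \mathit{then}\ S_t'\ \mathit{else}\ S_f'$. - if $l=l'\cup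 FV(b)$ and $S_t:(\mathit{pts},l')\to(\mathit{pts},l)\hookrightarrow S_t'$: $\mathit{while}\ b\ \mathit{do}\ S_t:(\mathit{pts},l)\to(\mathit{pts},l')\hookrightarrow\mathit{while}\ b\ \mathit{do}\ S_t'$. - (consequence) if $(\mathit{pts}_1',l_1')\le(\mathit{pts}_1,l_1)$, $S:(\mathit{pts}_1,l_1)\to(\mathit{pts}_2,l_2)\hookrightarrow S'$ and $(\mathit{pts}_2,l_2)\le(\mathit{pts}_2',l_2')$: $S:(\mathit{pts}_1',l_1')\to(\mathit{pts}_2',l_2')\hookrightarrow S'$. **Relations on states.** For $\gamma,\gamma'\in\Gamma$: $\gamma\models_l\mathit{pts}$ iff for all $x\in l$, $\gamma(x)\in\mathit{Addrs}$ implies $\gamma(x)\in\mathit{pts}(x)$; $\gamma\sim_l\gamma'$ iff $\gamma(x)=\gamma'(x)$ for all $x\in l$; $\gamma\sim_{(\mathit{pts},l)}\gamma'$ iff $\gamma\models_l\mathit{pts}$, $\gamma'\models_l\mathit{pts}$ and $\gamma\sim_l\gamma'$. *)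

(* Defs.v *)
From HB Require Import structures.
From mathcomp Require Import all_boot all_order all_fingroup all_algebra.
From mathcomp Require Import boolp classical_sets.

Set Implicit Arguments.
Unset Strict Implicit.
Unset Printing Implicit Defensive.

Import Order.TTheory GRing.Theory Num.Theory.
Local Open Scope classical_set_scope.

(* [Addr x] is the formal address written x' in mathematical notation. *)
Record addr (Var : Type) := Addr { base : Var }.
HB.instance Definition _ (Var : Type) := [isNew for @base Var].
HB.instance Definition _ (Var : eqType) := [Equality of addr Var by <:].

Section Language.
Variable Var : eqType.

Definition upd (T : Type) (f : Var -> T) (x : Var) (v : T) : Var -> T :=
  [eta f with x |-> v].

Inductive binop := Add | Sub | Mul.

Inductive aexpr :=
| EVar of Var
| ENum of int
| EOp of binop & aexpr & aexpr.

Inductive bexpr :=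
| BTrue
| BFalse
| BNot of bexpr
| BEq of aexpr & aexpr
| BLe of aexpr & aexpr
| BAnd of bexpr & bexpr
| BOr of bexpr & bexpr.

Fixpoint fva (e : aexpr) : set Var :=
  match e with
  | EVar x => [set x]
  | ENum _ => set0
  | EOp _ e1 e2 => fva e1 `|` fva e2
  end.

Fixpoint fvb (b : bexpr) : set Var :=
  match b with
  | BTrue | BFalse => set0
  | BNot b1 => fvb b1
  | BEq e1 e2 | BLe e1 e2 => fva e1 `|` fva e2
  | BAnd b1 b2 | BOr b1 b2 => fvb b1 `|` fvb b2
  end.

(* The parallel constructs take nonempty families, hence the index type
   ['I_n.+1] for a construct with n.+1 branches. *)
Inductive stmt :=
| Assign of Var & aexpr                                      (* x := e   *)
| AddrOf of Var & Var                                        (* x := & y *)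
| StoreTo of Var & aexpr                                     (* * x := e *)
| LoadFrom of Var & Var                                      (* x := * y *)
| Skip
| Seq of stmt & stmt
| If of bexpr & stmt & stmt
| While of bexpr & stmt
| Par (n : nat) of 'I_n.+1 -> stmt
| ParIf (n : nat) of 'I_n.+1 -> bexpr & 'I_n.+1 -> stmt
| ParFor of stmt.

Definition value : Type := (int + addr Var)%type.
Definition store : Type := Var -> value.
Inductive state := Normal of store | Abort.

(* In both evaluation functions [None] is the error value. *)

Definition binop_int (o : binop) (m n : int) : int :=
  match o with
  | Add => (m + n)%R
  | Sub => (m - n)%R
  | Mul => (m * n)%R
  end.

Fixpoint aeval (e : aexpr) (g : store) : option value :=
  match e with
  | EVar x => Some (g x)
  | ENum n => Some (inl n)
  | EOp o e1 e2 =>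
      match aeval e1 g, aeval e2 g with
      | Some (inl n1), Some (inl n2) => Some (inl (binop_int o n1 n2))
      | _, _ => None
      end
  end.

Fixpoint beval (b : bexpr) (g : store) : option bool :=
  match b with
  | BTrue => Some true
  | BFalse => Some false
  | BNot b1 => omap negb (beval b1 g)
  | BEq e1 e2 =>
      match aeval e1 g, aeval e2 g with
      | Some v1, Some v2 => Some (v1 == v2 :> (int + addr Var)%type)
      | _, _ => None
      end
  | BLe e1 e2 =>
      match aeval e1 g, aeval e2 g with
      | Some (inl n1), Some (inl n2) => Some (n1 <= n2)%R
      | _, _ => None
      end
  | BAnd b1 b2 =>
      match beval b1 g, beval b2 g with
      | Some c1, Some c2 => Some (c1 && c2)
      | _, _ => None
      end
  | BOr b1 b2 =>
      match beval b1 g, beval b2 g with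
      | Some c1, Some c2 => Some (c1 || c2)
      | _, _ => None
      end
  end.

Inductive exec : stmt -> store -> state -> Prop :=
| exec_assign_abort x e g :
    aeval e g = None ->
    exec (Assign x e) g Abort
| exec_assign x e g v :
    aeval e g = Some v ->
    exec (Assign x e) g (Normal (upd g x v))
| exec_addrof x y g :
    exec (AddrOf x y) g (Normal (upd g x (inr (Addr y))))
| exec_skip g :
    exec Skip g (Normal g)
| exec_store x e z g st :
    g x = inr (Addr z) ->
    exec (Assign z e) g st ->
    exec (StoreTo x e) g st
| exec_store_abort x e g :
    (forall a, g x <> inr a) ->
    exec (StoreTo x e) g Abort
| exec_load x y z g g' :
    g y = inr (Addr z) ->
    exec (Assign x (EVar z)) g (Normal g') ->
    exec (LoadFrom x y) g (Normal g')
| exec_load_abort x y g :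
    (forall a, g y <> inr a) ->
    exec (LoadFrom x y) g Abort
| exec_seq_abort S1 S2 g :
    exec S1 g Abort ->
    exec (Seq S1 S2) g Abort
| exec_seq S1 S2 g g'' st :
    exec S1 g (Normal g'') ->
    exec S2 g'' st ->
    exec (Seq S1 S2) g st
| exec_if_abort b St Sf g :
    beval b g = None ->
    exec (If b St Sf) g Abort
| exec_if_true b St Sf g st :
    beval b g = Some true ->
    exec St g st ->
    exec (If b St Sf) g st
| exec_if_false b St Sf g st :
    beval b g = Some false ->
    exec Sf g st ->
    exec (If b St Sf) g st
| exec_while_abort b St g :
    beval b g = None ->
    exec (While b St) g Abort
| exec_while_false b St g :
    beval b g = Some false ->
    exec (While b St) g (Normal g)
| exec_while_true_abort b St g :
    beval b g = Some true ->
    exec St g Abort ->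
    exec (While b St) g Abort
| exec_while_true b St g g'' st :
    beval b g = Some true ->
    exec St g (Normal g'') ->
    exec (While b St) g'' st ->
    exec (While b St) g st
(* The intermediate stores are [gs 0], ..., [gs n.+1]; the values of [gs]
   beyond that are irrelevant. *)
| exec_par n (S : 'I_n.+1 -> stmt) (theta : {perm 'I_n.+1})
    (gs : nat -> store) g g' :
    gs 0%N = g ->
    gs n.+1 = g' ->
    (forall i : 'I_n.+1, exec (S (theta i)) (gs i) (Normal (gs i.+1))) ->
    exec (Par S) g (Normal g')
(* Here m.+1 of the n.+1 branches are started: the first m terminate
   normally and the last one aborts. *)
| exec_par_abort n (S : 'I_n.+1 -> stmt) m (beta : 'I_m.+1 -> 'I_n.+1)
    (gs : nat -> store) g :
    (m <= n)%N ->
    injective beta ->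
    gs 0%N = g ->
    (forall i : 'I_m.+1, (i < m)%N ->
       exec (S (beta i)) (gs i) (Normal (gs i.+1))) ->
    exec (S (beta ord_max)) (gs m) Abort ->
    exec (Par S) g Abort
| exec_parif n (b : 'I_n.+1 -> bexpr) (S : 'I_n.+1 -> stmt) g st :
    exec (Par (fun i => If (b i) (S i) Skip)) g st ->
    exec (ParIf b S) g st
| exec_parfor n S g st :
    exec (Par (fun _ : 'I_n.+1 => S)) g st ->
    exec (ParFor S) g st.

Definition pts_type : Type := Var -> set (addr Var).

Definition pts_le (p q : pts_type) : Prop := forall x, p x `<=` q x.

Definition pts_cup (p q : pts_type) : pts_type := fun x => p x `|` q x.

Definition pts_bigcup (I : Type) (D : set I) (p : I -> pts_type) : pts_type :=
  fun x => \bigcup_(i in D) p i x.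

Definition targets (p : pts_type) (x : Var) : set Var :=
  [set z | p x (Addr z)].

Inductive aexpr_pts : aexpr -> pts_type -> set (addr Var) -> Prop :=
| aexpr_pts_num n p : aexpr_pts (ENum n) p set0
| aexpr_pts_var x p : aexpr_pts (EVar x) p (p x)
| aexpr_pts_op o e1 e2 p : aexpr_pts (EOp o e1 e2) p set0.

(* Only the assignment fragment of the pointer analysis: dead code elimination
   refers to it at assignments only. *)
Inductive assign_pts : stmt -> pts_type -> pts_type -> Prop :=
| assign_pts_assign x e p A :
    aexpr_pts e p A ->
    assign_pts (Assign x e) p (upd p x A)
| assign_pts_load x y p p' :
    (forall z, targets p y z -> assign_pts (Assign x (EVar z)) p p') ->
    assign_pts (LoadFrom x y) p p'
| assign_pts_store x e p p' :
    (forall z, targets p x z -> assign_pts (Assign z e) p p') ->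
    assign_pts (StoreTo x e) p p'
| assign_pts_csq S p1 p2 p1' p2' :
    pts_le p1' p1 ->
    assign_pts S p1 p2 ->
    pts_le p2 p2' ->
    assign_pts S p1' p2'.

Definition live_type : Type := (pts_type * set Var)%type.

Definition live_le (t t' : live_type) : Prop :=
  pts_le t.1 t'.1 /\ t'.2 `<=` t.2.

(* [dce S t t' S'] is the judgement S : t -> t' with output S'. *)
Inductive dce : stmt -> live_type -> live_type -> stmt -> Prop :=
| dce_assign_dead x e p p' (l' : set Var) :
    assign_pts (Assign x e) p p' ->
    ~ l' x ->
    dce (Assign x e) (p, l') (p', l') Skip
| dce_assign_live x e p p' (l' : set Var) :
    assign_pts (Assign x e) p p' ->
    l' x ->
    dce (Assign x e) (p, (l' `\ x) `|` fva e) (p', l') (Assign x e)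
| dce_addrof_dead x y p (l' : set Var) :
    ~ l' x ->
    dce (AddrOf x y) (p, l') (upd p x [set Addr y], l') Skip
| dce_addrof_live x y p (l' : set Var) :
    l' x ->
    dce (AddrOf x y) (p, l' `\ x) (upd p x [set Addr y], l') (AddrOf x y)
| dce_skip p l :
    dce Skip (p, l) (p, l) Skip
| dce_load_dead x y p p' (l' : set Var) :
    assign_pts (LoadFrom x y) p p' ->
    ~ l' x ->
    dce (LoadFrom x y) (p, l' `|` [set y]) (p', l') Skip
| dce_load_live x y p p' (l' : set Var) :
    assign_pts (LoadFrom x y) p p' ->
    l' x ->
    dce (LoadFrom x y) (p, (l' `\ x) `|` [set y] `|` targets p y) (p', l')
      (LoadFrom x y)
| dce_store_dead x e p p' (l' : set Var) :
    assign_pts (StoreTo x e) p p' ->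
    targets p x `&` l' = set0 ->
    dce (StoreTo x e) (p, l' `|` [set x]) (p', l') Skip
| dce_store_live x e p p' (l' : set Var) :
    assign_pts (StoreTo x e) p p' ->
    targets p x `&` l' <> set0 ->
    dce (StoreTo x e) (p, l' `|` [set x] `|` fva e) (p', l') (StoreTo x e)
| dce_par n (S S' : 'I_n.+1 -> stmt) p (ps : 'I_n.+1 -> pts_type)
    (l' : set Var) (ls : 'I_n.+1 -> set Var) :
    (forall i, dce (S i)
       (pts_cup p (pts_bigcup [set j | j != i] ps), ls i)
       (ps i, l' `|` \bigcup_(j in [set j | j != i]) ls j)
       (S' i)) ->
    dce (Par S) (p, \bigcup_(i in setT) ls i) (pts_bigcup setT ps, l') (Par S')
| dce_parif n (b : 'I_n.+1 -> bexpr) (S S' : 'I_n.+1 -> stmt) p l p' l' :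
    dce (Par (fun i => If (b i) (S i) Skip)) (p, l) (p', l')
      (Par (fun i => If (b i) (S' i) Skip)) ->
    dce (ParIf b S) (p, l) (p', l') (ParIf b S')
| dce_parfor S S' p l p' l' :
    dce S (pts_cup p p', l) (p', l' `|` l) S' ->
    dce (ParFor S) (p, l) (p', l') (ParFor S')
| dce_seq S1 S2 S1' S2' p l p'' l'' p' l' :
    dce S1 (p, l) (p'', l'') S1' ->
    dce S2 (p'', l'') (p', l') S2' ->
    dce (Seq S1 S2) (p, l) (p', l') (Seq S1' S2')
| dce_if b St Sf St' Sf' p l p' l' :
    dce St (p, l) (p', l') St' ->
    dce Sf (p, l) (p', l') Sf' ->
    dce (If b St Sf) (p, l `|` fvb b) (p', l') (If b St' Sf')
| dce_while b St St' p l l' :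
    l = l' `|` fvb b ->
    dce St (p, l') (p, l) St' ->
    dce (While b St) (p, l) (p, l') (While b St')
| dce_csq S S' t1 t2 t1' t2' :
    live_le t1' t1 ->
    dce S t1 t2 S' ->
    live_le t2 t2' ->
    dce S t1' t2' S'.

Definition models (l : set Var) (p : pts_type) (g : store) : Prop :=
  forall x, l x -> forall a, g x = inr a -> p x a.

Definition sim_on (l : set Var) (g g' : store) : Prop :=
  forall x, l x -> g x = g' x.

Definition sim (t : live_type) (g g' : store) : Prop :=
  [/\ models t.2 t.1 g, models t.2 t.1 g' & sim_on t.2 g g'].

End Language.

Arguments Skip {Var}.
Arguments Abort {Var}.

(* Main.v *)
Require Import Defs.
From mathcomp Require Import all_boot all_order all_algebra.
From mathcomp Require Import boolp classical_sets.
From mathcomp Require Import all_fingroup.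

(** Induction on the derivation: the original statement run from [g] and the
    transformed one run from [gs] simulate each other whenever the two stores
    agree on the live variables and the points-to type covers the addresses
    held there.  For a parallel construct, the type reached after any branch
    lies below the initial type of every other branch, so branches may be
    chained in any order; in the converse direction a branch of the original
    program cannot abort, since the prefix executed so far followed by that
    branch would be an abort of the whole construct. *)

Set Implicit Arguments.
Unset Strict Implicit.
Unset Printing Implicit Defensive.

Local Open Scope classical_set_scope.

Section Soundness.
Variable Var : eqType.
Implicit Types (S : stmt Var) (g h : store Var) (t : live_type Var).
Implicit Types (p : pts_type Var) (l : set Var).

(** * Semantic soundness and inversion of executions *)

Definition sound S t t' S' : Prop :=
  forall g gs, sim t g gs ->
  (forall g', exec S g (Normal g') ->
     exists gs', exec S' gs (Normal gs') /\ sim t' g' gs') /\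
  (forall gs', exec S' gs (Normal gs') -> ~ exec S g Abort ->
     exists g', exec S g (Normal g') /\ sim t' g' gs').

(** Merging the rules of each construct spares repeated dependent inversions. [While] carries no
    information because loops are treated by induction on the execution itself, and [Par] is
    inverted for normal outcomes only, since the simulation never starts from an aborting run. *)
Lemma exec_inv S g st : exec S g st ->
  match S with
  | Assign x e =>
      st = if aeval e g is Some v then Normal (upd g x v) else Abort
  | AddrOf x y => st = Normal (upd g x (inr (Addr y)))
  | StoreTo x e =>
      st = match g x, aeval e g with
           | inr a, Some v => Normal (upd g (base a) v)
           | _, _ => Abort
           end
  | LoadFrom x y =>
      st = if g y is inr a then Normal (upd g x (g (base a))) else Abort
  | Skip => st = Normal g
  | Seq S1 S2 => (exec S1 g Abort /\ st = Abort) \/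
      exists2 h, exec S1 g (Normal h) & exec S2 h st
  | If b St Sf =>
      if beval b g is Some c then exec (if c then St else Sf) g st
      else st = Abort
  | While b St => True
  | Par n Ss => forall g', st = Normal g' ->
      exists (theta : {perm 'I_n.+1}) (hs : nat -> store Var),
        [/\ hs 0%N = g, hs n.+1 = g' &
            forall i : 'I_n.+1, exec (Ss (theta i)) (hs i) (Normal (hs i.+1))]
  | ParIf n b Ss => exec (Par (fun i => If (b i) (Ss i) Skip)) g st
  | ParFor St => exists n, exec (Par (fun _ : 'I_n.+1 => St)) g st
  end.
Proof.
elim=> {S g st}; try by [].
- by move=> x e g ->.
- by move=> x e g v ->.
- by move=> x e z g st -> _ ->; case: (aeval e g).
- by move=> x e g; case: (g x) => [//|a] /(_ a).
- by move=> x y z g g' -> _ ->.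
- by move=> x y g; case: (g y) => [//|a] /(_ a).
- by left.
- by move=> S1 S2 g g'' st ? _ ? _; right; exists g''.
- by move=> b St Sf g ->.
- by move=> b St Sf g st ->.
- by move=> b St Sf g st ->.
- by move=> n S theta hs g g' h0 hn hS _ g1 [<-]; exists theta, hs.
- by move=> n S g st ? _; exists n.
Qed.

Lemma exec_load_addr x y (a : addr Var) g : g y = inr a ->
  exec (LoadFrom x y) g (Normal (upd g x (g (base a)))).
Proof. by case: a => z gy; apply: exec_load gy _; apply: exec_assign. Qed.

Lemma exec_store_addr x e (a : addr Var) g v : g x = inr a ->
  aeval e g = Some v -> exec (StoreTo x e) g (Normal (upd g (base a) v)).
Proof. by case: a => z gx ev; apply: exec_store gx _; apply: exec_assign. Qed.

Lemma nabort_assign x e g : ~ exec (Assign x e) g Abort ->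
  exists v, aeval e g = Some v.
Proof.
case E: (aeval e g) => [v|] nA; first by exists v.
by case: nA; apply: exec_assign_abort.
Qed.

Lemma nabort_load x y g : ~ exec (LoadFrom x y) g Abort ->
  exists a, g y = inr a.
Proof.
case E: (g y) => [n|a] nA; last by exists a.
by case: nA; apply: exec_load_abort => a; rewrite E.
Qed.

Lemma nabort_store x e g : ~ exec (StoreTo x e) g Abort ->
  exists a v, g x = inr a /\ aeval e g = Some v.
Proof.
case E: (g x) => [n|[z]] nA.
  by case: nA; apply: exec_store_abort => a; rewrite E.
have [|v ev] := @nabort_assign z e g; last by exists (Addr z), v.
by move=> A; apply: nA; apply: exec_store E A.
Qed.

(** * Values of expressions and points-to judgements *)

Lemma aeval_sim_on e g h : sim_on (fva e) g h -> aeval e g = aeval e h.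
Proof.
elim: e => [x|//|o e1 IH1 e2 IH2] /= gh; first by rewrite gh.
by rewrite IH1 ?IH2 // => x ?; apply: gh; [right|left].
Qed.

Lemma beval_sim_on b g h : sim_on (fvb b) g h -> beval b g = beval b h.
Proof.
elim: b => [||b IH|e1 e2|e1 e2|b1 IH1 b2 IH2|b1 IH1 b2 IH2] //= gh;
  first by rewrite IH.
all: have gh1 := fun x H => gh x (or_introl H).
all: have gh2 := fun x H => gh x (or_intror H).
- by rewrite (aeval_sim_on gh1) (aeval_sim_on gh2).
- by rewrite (aeval_sim_on gh1) (aeval_sim_on gh2).
- by rewrite IH1 ?IH2.
- by rewrite IH1 ?IH2.
Qed.

(** Literals and operators produce integers only, so an address must have been copied from a
    variable. This justifies giving the empty points-to set to every other expression. *)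
Lemma aeval_addr e g (a : addr Var) :
  aeval e g = Some (inr a) -> exists2 z, e = EVar z & g z = inr a.
Proof.
case: e => [z [gz]|//|o e1 e2 /=]; first by exists z.
by case: (aeval e1 g) => [[?|?]|] //; case: (aeval e2 g) => [[?|?]|].
Qed.

(** Consequence steps may end the derivation at any depth, hence an induction. For a direct
    assignment only those inclusions are kept that survive shrinking [p] and enlarging [p']. *)
Lemma assign_pts_inv S p p' : assign_pts S p p' ->
  match S with
  | Assign x e => (forall y, y != x -> p y `<=` p' y) /\
      (forall z, e = EVar z -> p z `<=` p' x)
  | LoadFrom x y =>
      forall z, targets p y z -> assign_pts (Assign x (EVar z)) p p'
  | StoreTo x e => forall z, targets p x z -> assign_pts (Assign z e) p p'
  | _ => True
  end.
Proof.
elim=> {S p p'} //.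
- move=> x e p A eA; split=> [y yx a|z ez a]; rewrite /upd /=.
    by rewrite (negbTE yx).
  by rewrite eqxx; case: eA ez => // x0 ? [->].
- move=> S p1 p2 p1' p2' le1 pS IH le2.
  case: S pS IH => [x e|//|x e|x y|||||||] // _ IH.
  + case: IH => IH1 IH2; split=> [y yx|z ez].
      by apply: subset_trans (le1 y) _; apply: subset_trans (IH1 _ yx) _.
    by apply: subset_trans (le1 z) _; apply: subset_trans (IH2 _ ez) _.
  + by move=> z /le1 /IH ?; apply: assign_pts_csq le1 _ le2.
  + by move=> z /le1 /IH ?; apply: assign_pts_csq le1 _ le2.
Qed.

(** * Updates of related stores *)

Lemma models_upd l l' p p' g x v :
  (forall y, y != x -> l' y -> l y /\ p y `<=` p' y) ->
  (l' x -> forall a, v = inr a -> p' x a) ->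
  models l p g -> models l' p' (upd g x v).
Proof.
move=> lp px m y ly a; rewrite /upd /=; case: eqP ly => [-> ?|/eqP yx ly].
  exact: px.
by have [ly' pp] := lp y yx ly => /(m _ ly') /pp.
Qed.

Lemma models_notin l l' p p' g x : ~ l' x ->
  (forall y, y != x -> l' y -> l y /\ p y `<=` p' y) ->
  models l p g -> models l' p' g.
Proof.
move=> nx lp m y ly a; have [yx|yx] := eqVneq y x; first by rewrite yx in ly.
by have [ly' pp] := lp y yx ly => /(m _ ly') /pp.
Qed.

Lemma sim_upd_both l l' p p' g gs x v :
  (forall y, y != x -> l' y -> l y /\ p y `<=` p' y) ->
  (l' x -> forall a, v = inr a -> p' x a) ->
  sim (p, l) g gs -> sim (p', l') (upd g x v) (upd gs x v).
Proof.
move=> lp px [m1 m2 e].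
split; [exact: models_upd lp px m1|exact: models_upd lp px m2|].
move=> y ly; rewrite /upd /=; case: eqP => // /eqP yx.
by apply: e; case: (lp y yx ly).
Qed.

(** This is the effect of an eliminated assignment: only the original store changes, at a variable
    that the final relation does not inspect. *)
Lemma sim_upd_dead l l' p p' g gs x v : ~ l' x ->
  (forall y, y != x -> l' y -> l y /\ p y `<=` p' y) ->
  sim (p, l) g gs -> sim (p', l') (upd g x v) gs.
Proof.
move=> nx lp [m1 m2 e]; split; [|exact: models_notin nx lp m2|].
  by apply: models_upd lp _ m1.
move=> y ly; rewrite /upd /=; case: eqP ly => [->//|/eqP yx ly].
by apply: e; case: (lp y yx ly).
Qed.

Lemma sim_assign l l' p p' g gs x e v : assign_pts (Assign x e) p p' ->
  l' `\ x `<=` l -> fva e `<=` l -> aeval e g = Some v ->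
  sim (p, l) g gs -> sim (p', l') (upd g x v) (upd gs x v).
Proof.
move=> /assign_pts_inv[pp px] ll el ev gg; apply: sim_upd_both (gg).
  by move=> y yx ly; split; [apply: ll; split=> //; exact/eqP|exact: pp].
(* If the assigned value is an address, [e] is a variable [z]. It is live beforehand, so [p z]
   covers the address, and [p z] is included in [p' x]. *)
move=> _ a va; rewrite va in ev; have [z ez gz] := aeval_addr ev.
apply: (px z ez); case: gg => m _ _; apply: m gz.
by apply: el; rewrite ez.
Qed.

Lemma sim_assign_dead l l' p p' g gs x e v : assign_pts (Assign x e) p p' ->
  l' `<=` l -> ~ l' x -> sim (p, l) g gs -> sim (p', l') (upd g x v) gs.
Proof.
move=> /assign_pts_inv[pp _] ll nx; apply: sim_upd_dead => // y yx ly.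
by split; [exact: ll|exact: pp].
Qed.

Lemma sim_le t t' g gs : live_le t t' -> sim t g gs -> sim t' g gs.
Proof.
by move=> [pp ll] [m1 m2 e]; split=> [x /ll lx a|x /ll lx a|x /ll /e//];
  [move/(m1 _ lx)/pp|move/(m2 _ lx)/pp].
Qed.

Lemma live_le_live p l l' : l' `<=` l -> live_le (p, l) (p, l').
Proof. by split=> // x. Qed.

Lemma sound_le S S' t1 t2 t1' t2' : live_le t1' t1 -> live_le t2 t2' ->
  sound S t1 t2 S' -> sound S t1' t2' S'.
Proof.
move=> le1 le2 sS g gs /(sim_le le1) /sS[A B]; split=> [g'|gs'].
  by move=> /A[gs' [? ?]]; exists gs'; split=> //; apply: sim_le le2 _.
by move=> /B + nA => /(_ nA)[g' [? ?]]; exists g'; split=> //;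
  apply: sim_le le2 _.
Qed.

(** * Elementary statements *)

Lemma sound_assign_dead x e p p' l' : assign_pts (Assign x e) p p' ->
  ~ l' x -> sound (Assign x e) (p, l') (p', l') Skip.
Proof.
move=> pp nx g gs gg; split.
  move=> g' /exec_inv; case ev: (aeval e g) => [v|//] [->].
  by exists gs; split; [exact: exec_skip|exact: sim_assign_dead pp _ nx gg].
(* [Skip] runs even where [e] is erroneous; the value [v] comes from the assumption that the
   original does not abort. *)
move=> gs' /exec_inv[->] /nabort_assign[v ev].
exists (upd g x v); split; first exact: exec_assign.
exact: sim_assign_dead pp _ nx gg.
Qed.

Lemma sound_assign_live x e p p' l' : assign_pts (Assign x e) p p' ->
  sound (Assign x e) (p, (l' `\ x) `|` fva e) (p', l') (Assign x e).
Proof.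
move=> pp g gs gg.
have eg : aeval e g = aeval e gs.
  by apply: aeval_sim_on => y ?; case: gg => _ _; apply; right.
have S v : aeval e g = Some v ->
    sim (p', l') (upd g x v) (upd gs x v).
  by move=> ev; apply: sim_assign pp _ _ ev gg => y; [left|right].
split.
  move=> g' /exec_inv; case ev: (aeval e g) => [v|//] [->].
  exists (upd gs x v); split; last exact: S.
  by apply: exec_assign; rewrite -eg.
move=> gs' /exec_inv; rewrite -eg; case ev: (aeval e g) => [v|//] [->] _.
by exists (upd g x v); split; [exact: exec_assign|exact: S].
Qed.

Lemma sound_addrof_dead x y p l' : ~ l' x ->
  sound (AddrOf x y) (p, l') (upd p x [set Addr y], l') Skip.
Proof.
move=> nx g gs gg.
have S : sim (upd p x [set Addr y], l') (upd g x (inr (Addr y))) gs.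
  apply: (sim_upd_dead _ nx _ gg) => z zx lz.
  by rewrite /upd /= (negbTE zx); split.
split=> [g' /exec_inv[->]|gs' /exec_inv[->] _].
  by exists gs; split=> //; exact: exec_skip.
by exists (upd g x (inr (Addr y))); split=> //; exact: exec_addrof.
Qed.

Lemma sound_addrof_live x y p l' :
  sound (AddrOf x y) (p, l' `\ x) (upd p x [set Addr y], l') (AddrOf x y).
Proof.
move=> g gs gg.
have S : sim (upd p x [set Addr y], l') (upd g x (inr (Addr y)))
    (upd gs x (inr (Addr y))).
  apply: sim_upd_both gg => [z zx lz|_ a [<-]].
    by rewrite /upd /= (negbTE zx); split=> //; split=> //; exact/eqP.
  by rewrite /upd /= eqxx.
split=> [g' /exec_inv[->]|gs' /exec_inv[->] _].
  by exists (upd gs x (inr (Addr y))); split=> //; exact: exec_addrof.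
by exists (upd g x (inr (Addr y))); split=> //; exact: exec_addrof.
Qed.

Lemma sound_skip t : sound Skip t t Skip.
Proof.
by move=> g gs gg; split=> [g' /exec_inv[->]|gs' /exec_inv[->] _];
  [exists gs|exists g]; split=> //; exact: exec_skip.
Qed.

(** Liveness of [y] before the load makes [models] cover the address held in [y]. The cell really
    read is thus among the targets over which the typing quantifies, and the load acts as a dead
    direct assignment. *)
Lemma sound_load_dead x y p p' l' : assign_pts (LoadFrom x y) p p' ->
  ~ l' x -> sound (LoadFrom x y) (p, l' `|` [set y]) (p', l') Skip.
Proof.
move=> /assign_pts_inv pp nx g gs gg.
have S (a : addr Var) : g y = inr a ->
    sim (p', l') (upd g x (g (base a))) gs.
  move=> gy; have /pp : targets p y (base a).
    by case: gg => m _ _; apply: m; [right|case: a gy].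
  by move=> ap; apply: sim_assign_dead ap _ nx gg; left.
split=> [g' /exec_inv|gs' /exec_inv[->] /nabort_load[a gy]].
  case gy: (g y) => [//|a] [->].
  by exists gs; split; [exact: exec_skip|exact: S].
by exists (upd g x (g (base a))); split; [exact: exec_load_addr|exact: S].
Qed.

Lemma sound_load_live x y p p' l' : assign_pts (LoadFrom x y) p p' ->
  sound (LoadFrom x y) (p, (l' `\ x) `|` [set y] `|` targets p y) (p', l')
    (LoadFrom x y).
Proof.
move=> /assign_pts_inv pp g gs gg.
have gy : g y = gs y by case: gg => _ _; apply; left; right.
have S (a : addr Var) : g y = inr a -> g (base a) = gs (base a) /\
    sim (p', l') (upd g x (g (base a))) (upd gs x (gs (base a))).
  move=> ga; have tz : targets p y (base a).
    by case: gg => m _ _; apply: m; [left; right|case: a ga].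
  (* The cell read is a target of [y], and all targets are live beforehand. *)
  have <- : g (base a) = gs (base a) by case: gg => _ _; apply; right.
  split=> //; apply: sim_assign (pp _ tz) _ _ _ gg => //.
    by move=> z ?; left; left.
  by move=> z ->; right.
split=> [g' /exec_inv|gs' /exec_inv].
  case ga: (g y) => [//|a] [->]; exists (upd gs x (gs (base a))).
  by split; [apply: exec_load_addr; rewrite -gy|case: (S a ga)].
rewrite -gy; case ga: (g y) => [//|a] [->] _.
exists (upd g x (g (base a))).
by split; [exact: exec_load_addr|case: (S a ga)].
Qed.

(** The cell written is a target of [x], and no target is live afterwards, so the store acts as a
    dead assignment to that cell. *)
Lemma sound_store_dead x e p p' l' : assign_pts (StoreTo x e) p p' ->
  targets p x `&` l' = set0 ->
  sound (StoreTo x e) (p, l' `|` [set x]) (p', l') Skip.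
Proof.
move=> /assign_pts_inv pp tl g gs gg.
have S (a : addr Var) v : g x = inr a -> sim (p', l') (upd g (base a) v) gs.
  move=> gx; have tz : targets p x (base a).
    by case: gg => m _ _; apply: m; [right|case: a gx].
  apply: sim_assign_dead (pp _ tz) _ _ gg; first by left.
  by move=> lz; have : set0 (base a) by rewrite -tl.
split=> [g' /exec_inv|gs' /exec_inv[->] /nabort_store[a [v [gx ev]]]].
  case gx: (g x) => [//|a]; case: (aeval e g) => [v|//] [->].
  by exists gs; split; [exact: exec_skip|exact: S].
by exists (upd g (base a) v); split; [exact: exec_store_addr|exact: S].
Qed.

(** Since [x] is live, both programs write to the same cell. Which target that is depends on the
    run, so the whole of [l'] stays live beforehand. *)
Lemma sound_store_live x e p p' l' : assign_pts (StoreTo x e) p p' ->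
  sound (StoreTo x e) (p, l' `|` [set x] `|` fva e) (p', l') (StoreTo x e).
Proof.
move=> /assign_pts_inv pp g gs gg.
have gx : g x = gs x by case: gg => _ _; apply; left; right.
have eg : aeval e g = aeval e gs.
  by apply: aeval_sim_on => y ?; case: gg => _ _; apply; right.
have S (a : addr Var) v : g x = inr a -> aeval e g = Some v ->
    sim (p', l') (upd g (base a) v) (upd gs (base a) v).
  move=> ga ev; have tz : targets p x (base a).
    by case: gg => m _ _; apply: m; [left; right|case: a ga].
  by apply: sim_assign (pp _ tz) _ _ ev gg => y; [case; left; left|right].
split=> [g' /exec_inv|gs' /exec_inv].
  case ga: (g x) => [//|a]; case ev: (aeval e g) => [v|//] [->].
  exists (upd gs (base a) v); split; last exact: S.
  by apply: exec_store_addr; rewrite -?gx -?eg.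
rewrite -gx -eg; case ga: (g x) => [//|a]; case ev: (aeval e g) => [v|//].
case=> -> _; exists (upd g (base a) v).
by split; [exact: exec_store_addr|exact: S].
Qed.

(** * Sequencing, conditionals and loops *)

Lemma sound_seq S1 S2 S1' S2' t t'' t' : sound S1 t t'' S1' ->
  sound S2 t'' t' S2' -> sound (Seq S1 S2) t t' (Seq S1' S2').
Proof.
move=> s1 s2 g gs /s1[A1 B1]; split=> [g' /exec_inv|gs' /exec_inv].
  case=> [[_ //]|[h /A1[hs [e1 /s2[A2 _]]] /A2[gs' [e2 ?]]]].
  by exists gs'; split=> //; apply: exec_seq e1 e2.
case=> [[_ //]|[hs e1 e2]] nA.
have [|h [f1 /s2[_ B2]]] := B1 _ e1.
  by move=> A; apply: nA; apply: exec_seq_abort.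
have [|g' [f2 ?]] := B2 _ e2.
  by move=> A; apply: nA; apply: exec_seq f1 A.
by exists g'; split=> //; apply: exec_seq f1 f2.
Qed.

Lemma exec_if b St Sf g c st : beval b g = Some c ->
  exec (if c then St else Sf) g st -> exec (If b St Sf) g st.
Proof. by case: c; [exact: exec_if_true|exact: exec_if_false]. Qed.

Lemma sound_if b St Sf St' Sf' p l t' :
  sound St (p, l) t' St' -> sound Sf (p, l) t' Sf' ->
  sound (If b St Sf) (p, l `|` fvb b) t' (If b St' Sf').
Proof.
move=> st sf g gs gg.
have bg : beval b g = beval b gs.
  by apply: beval_sim_on => y ?; case: gg => _ _; apply; right.
have {}gg : sim (p, l) g gs by apply: sim_le gg; apply: live_le_live; left.
have sc c : sound (if c then St else Sf) (p, l) t' (if c then St' else Sf').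
  by case: c.
split=> [g' /exec_inv|gs' /exec_inv].
  case bc: (beval b g) => [c|//]; have [A _] := sc c _ _ gg => /A[gs' [? ?]].
  by exists gs'; split=> //; apply: exec_if; first by rewrite -bg bc.
rewrite -bg; case bc: (beval b g) => [c|//]; have [_ B] := sc c _ _ gg.
move=> /B + nA; case=> [|g' [? ?]]; first by move/(exec_if bc).
by exists g'; split=> //; apply: exec_if bc _.
Qed.

(** By induction on the execution of the loop. Entering the body forgets the variables of the guard
    ([weak]); the final type of the body restores them, so the relation needed for the next test
    holds again. *)
Lemma sound_while b St St' p l' :
  sound St (p, l') (p, l' `|` fvb b) St' ->
  sound (While b St) (p, l' `|` fvb b) (p, l') (While b St').
Proof.
set l := l' `|` fvb b => sS.
have bg g gs : sim (p, l) g gs -> beval b g = beval b gs.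
  by case=> _ _ gg; apply: beval_sim_on => y ?; apply: gg; right.
have weak g gs : sim (p, l) g gs -> sim (p, l') g gs.
  by apply: sim_le; apply: live_le_live; left.
move=> g gs gg; split=> [g' ex|gs' ex].
- move EW: (While b St) ex => W; move EN: (Normal g') => st ex.
  elim: ex EW EN gs gg => {W st g} //.
    move=> ? ? g bf [E _] [->] gs gg; rewrite -{}E in bf.
    exists gs; split; last exact: weak.
    by apply: exec_while_false; rewrite -(bg _ _ gg).
  move=> ? ? g g'' st bt ex _ _ IH [E1 E2]; rewrite -{}E1 -{}E2 in bt ex IH *.
  move=> Est gs gg; have [A _] := sS _ _ (weak _ _ gg).
  have [hs [e1 gh]] := A _ ex; have [//|gs' [e2 ?]] := IH erefl _ hs gh.
  exists gs'; split=> //; apply: exec_while_true e1 e2.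
  by rewrite -(bg _ _ gg).
- move EW: (While b St') ex => W; move EN: (Normal gs') => st ex.
  elim: ex EW EN g gg => {W st gs} //.
    move=> ? ? gs bf [E _] [->] g gg _; rewrite -{}E in bf.
    exists g; split; last exact: weak.
    by apply: exec_while_false; rewrite (bg _ _ gg).
  move=> ? ? gs hs st bt ex _ _ IH [E1 E2]; rewrite -{}E1 -{}E2 in bt ex IH *.
  move=> Est g gg nA; have [_ B] := sS _ _ (weak _ _ gg).
  rewrite -(bg _ _ gg) in bt.
  have [|h [e1 gh]] := B _ ex.
    by move=> A; apply: nA; apply: exec_while_true_abort.
  (* The remaining iterations cannot abort from [h], as the whole loop would then abort from [g]. *)
  have [//||g' [e2 ?]] := IH erefl _ h gh.
    by move=> A; apply: nA; apply: exec_while_true e1 A.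
  by exists g'; split=> //; apply: exec_while_true e1 e2.
Qed.

(** * Parallel composition *)

(** Builds a run stepwise under an invariant. Each step may use the entire prefix, because excluding
    an abort of a branch requires the run that led to it. *)
Lemma chain (T : Type) n (R : nat -> T -> T -> Prop) (Q : nat -> T -> Prop) x0 :
  Q 0%N x0 ->
  (forall k (xs : nat -> T), (k < n)%N -> xs 0%N = x0 ->
     (forall i, (i < k)%N -> R i (xs i) (xs i.+1)) -> Q k (xs k) ->
     exists y, R k (xs k) y /\ Q k.+1 y) ->
  exists xs : nat -> T,
    [/\ xs 0%N = x0, forall i, (i < n)%N -> R i (xs i) (xs i.+1) & Q n (xs n)].
Proof.
move=> Q0; elim: n => [|n IH] step; first by exists (fun=> x0).
have [k xs kn|xs [xs0 xsR xsQ]] := IH; first by apply: step; rewrite ltnW.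
have [y [Ry Qy]] := step n xs (ltnSn n) xs0 xsR xsQ.
(* The new state [y] sits at index [n.+1]; later values do not matter. *)
exists (fun i => if (i <= n)%N then xs i else y); split; rewrite ?ltnn //.
move=> i; rewrite ltnS leq_eqVlt => /predU1P[->|ltin].
  by rewrite eqxx ltnn.
by rewrite ltin orbT; apply: xsR.
Qed.

(** The types of the branches enter through order relations only, so that both distinct branches and
    copies of one statement are instances. *)
Lemma sound_par n (S S' : 'I_n.+1 -> stmt Var) t t'
    (pre post : 'I_n.+1 -> live_type Var) :
  (forall i, sound (S i) (pre i) (post i) (S' i)) ->
  (forall i, live_le t (pre i)) ->
  (forall i j, i != j -> live_le (post i) (pre j)) ->
  (forall i, live_le (post i) t') ->
  sound (Par S) t t' (Par S').
Proof.
move=> sS tpre postpre postt g gs gg.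
(* The type reached after [k] branches in the order [theta]: initially [t], then the final type of
   the branch run last, whose position is [k - 1]. *)
pose ty (theta : {perm 'I_n.+1}) k :=
  if k is k'.+1 then post (theta (inord k')) else t.
have ty_pre theta k h hs : (k < n.+1)%N -> sim (ty theta k) h hs ->
    sim (pre (theta (inord k))) h hs.
  case: k => [|k] kn; apply: sim_le; first exact: tpre.
  (* Consecutive positions carry different branches because [theta] is injective. *)
  apply: postpre; rewrite (inj_eq perm_inj) -(inj_eq val_inj) /=.
  by rewrite !inordK ?ltn_eqF // ltnW.
split=> [g' /exec_inv /(_ g' erefl)|gs' /exec_inv /(_ gs' erefl)].
  move=> [theta [hs [hs0 hsn hsS]]].
  have [||xs [xs0 xsR xsQ]] := @chain _ n.+1
    (fun i h h' => exec (S' (theta (inord i))) h (Normal h'))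
    (fun k h => sim (ty theta k) (hs k) h) gs; first by rewrite hs0.
    move=> k xs kn _ _ /(ty_pre _ _ _ _ kn) /sS[A _].
    by apply: A; have := hsS (inord k); rewrite inordK.
  (* At [n.+1] the type [ty] is the final type of the last branch, which lies below [t']. *)
  exists (xs n.+1); split; last by rewrite -hsn; apply: sim_le (postt _) xsQ.
  apply: (exec_par (theta := theta) xs0) => // i.
  by have := xsR i (ltn_ord i); rewrite inord_val.
move=> [theta [hs [hs0 hsn hsS]]] nA.
have [||xs [xs0 xsR xsQ]] := @chain _ n.+1
  (fun i h h' => exec (S (theta (inord i))) h (Normal h'))
  (fun k h => sim (ty theta k) h (hs k)) g; first by rewrite hs0.
  move=> k xs kn xs0 xsR /(ty_pre _ _ _ _ kn) /sS[_ B].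
  apply: B; first by have := hsS (inord k); rewrite inordK.
  move=> A; apply: nA.
  (* The prefix [xs] has completed [k] branches, and branch number [k] in the order [theta] is the
     aborting one. *)
  apply: (@exec_par_abort _ n S k (fun i => theta (inord i)) xs g) => //.
    move=> i j /perm_inj /(congr1 val) /=.
    by rewrite !inordK ?(leq_trans (ltn_ord _)) // => /val_inj.
  by move=> i /xsR.
exists (xs n.+1); split; last by rewrite -hsn; apply: sim_le (postt _) xsQ.
apply: (exec_par (theta := theta) xs0) => // i.
by have := xsR i (ltn_ord i); rewrite inord_val.
Qed.

(** * Induction over the elimination judgement *)

Lemma dce_sound S t t' S' : dce S t t' S' -> sound S t t' S'.
Proof.
elim=> {S t t' S'}.
- by move=> *; apply: sound_assign_dead.
- by move=> *; apply: sound_assign_live.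
- by move=> *; apply: sound_addrof_dead.
- by move=> *; apply: sound_addrof_live.
- by move=> *; apply: sound_skip.
- by move=> *; apply: sound_load_dead.
- by move=> *; apply: sound_load_live.
- by move=> *; apply: sound_store_dead.
- by move=> *; apply: sound_store_live.
- move=> n S S' p ps l' ls _ sS; apply: sound_par sS _ _ _.
  + by move=> i; split=> [x a|x lx] /=; [left|exists i].
  (* Branch [j] assumes the points-to types of all other branches, among them [ps i]; branch [i]
     keeps live what all others need, among them [ls j]. *)
  + move=> i j ij; split=> [x a pa|x lx] /=; first by right; exists i.
    by right; exists j => //; rewrite /= eq_sym.
  + by move=> i; split=> [x a pa|x lx] /=; [exists i|left].
- move=> n b S S' p l p' l' _ sS g gs /sS[A B].
  split=> [g' /exec_inv /A[gs' [? ?]]|gs' /exec_inv /B + nA].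
    by exists gs'; split=> //; apply: exec_parif.
  by case=> [/exec_parif//|g' [? ?]]; exists g'; split=> //; apply: exec_parif.
- move=> S S' p l p' l' _ sS.
  (* The run chooses the number of copies, so every [n] is treated; the simulating run then uses the
     same number. All copies share the type of the body, whose final type lies below its initial
     one. *)
  have sP n : sound (Par (fun _ : 'I_n.+1 => S)) (p, l) (p', l')
      (Par (fun _ : 'I_n.+1 => S')).
    apply: (sound_par (fun=> sS)) => *; split=> x //=; [by left|by right| |].
      by right.
    by left.
  move=> g gs gg; split=> [g' /exec_inv|gs' /exec_inv] [n].
    have [A _] := sP n _ _ gg => /A[gs' [? ?]].
    by exists gs'; split=> //; apply: (@exec_parfor _ n).
  have [_ B] := sP n _ _ gg => /B + nA.
  case=> [/exec_parfor//|g' [? ?]].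
  by exists g'; split=> //; apply: (@exec_parfor _ n).
- by move=> S1 S2 S1' S2' p l p'' l'' p' l' _ s1 _; apply: sound_seq.
- by move=> b St Sf St' Sf' p l p' l' _ s1 _; apply: sound_if.
- by move=> b St St' p l l' -> _; apply: sound_while.
- by move=> S S' t1 t2 t1' t2' le1 _ sS le2; apply: sound_le sS.
Qed.

End Soundness.

Theorem theorem4 (Var : eqType) (S S' : stmt Var) (pts pts' : pts_type Var)
    (l l' : set Var) (g gs : store Var)
    (Hdce : dce S (pts, l) (pts', l') S')
    (Hsim : sim (pts, l) g gs) :
  (forall g' : store Var, exec S g (Normal g') ->
     exists gs' : store Var,
       exec S' gs (Normal gs') /\ sim (pts', l') g' gs')
  /\
  (forall gs' : store Var, exec S' gs (Normal gs') ->
     ~ exec S g Abort ->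
     exists g' : store Var,
       exec S g (Normal g') /\ sim (pts', l') g' gs').
Proof. exact: dce_sound Hdce _ _ Hsim. Qed.
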